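(* Let $(\Omega,\Sigma,\mu)$ be a finite and positive measure space, let $(\mathcal{X},\|\cdot\|)$ be a separable Banach space, and let $r>0$. The set valued map $p\mapsto B_{\Omega,\mathcal{X},p}(r)$, $p\in(1,+\infty)$, is continuous, i.e. for each fixed $p_*>1$ and $\varepsilon\in(0,\sigma_* )$ there exists $\delta_0(\varepsilon)\in\left(0,\frac{p_*-1}{2}\right]$ such that for every $p\in(p_*-\delta_0(\varepsilon),p_*+\delta_0(\varepsilon))$ the inequality $$\mathcal{H}_1\left(B_{\Omega,\mathcal{X},p}(r),B_{\Omega,\mathcal{X},p_*}(r)\right)\leq\varepsilon$$ holds; here $\delta_0(\varepsilon)=\min\{\delta_*(\varepsilon),\delta^*(\varepsilon)\}$, where $\sigma_*$ and the numbers $\delta_*(\varepsilon),\delta^*(\varepsilon)\in\left(0,\frac{p_*-1}{2}\right]$ (all depending also on $p_*$) are given by the explicit formulas in the context.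
   Context: For $p\ge 1$, $L_p(\Omega,\Sigma,\mu;\mathcal{X})$ is the Bochner space of (equivalence classes of) $\mu$-measurable functions $x:\Omega\to\mathcal{X}$ with $\|x\|_p=\left(\int_\Omega\|x(s)\|^p\mu(ds)\right)^{1/p}<+\infty$, and $B_{\Omega,\mathcal{X},p}(r)=\{x\in L_p(\Omega,\Sigma,\mu;\mathcal{X}):\|x\|_p\le r\}$. Since $\mu$ is finite, $L_p\subset L_1$. For bounded sets $Y\subset L_{p_1}(\Omega,\Sigma,\mu;\mathcal{X})$ and $W\subset L_{p_2}(\Omega,\Sigma,\mu;\mathcal{X})$, $p_1,p_2\ge 1$, $$\mathcal{H}_1(Y,W)=\max\left\{\sup_{y\in Y}d_1(y,W),\ \sup_{w\in W}d_1(w,Y)\right\},\qquad d_1(y,W)=\inf\{\|y-w\|_1:w\in W\}.$$ For fixed $p_*>1$ and $\varepsilon>0$ put $$c_*=\max\left\{\max\left\{r^{\frac{p-p_*}{p}}:p\in[p_*,2p_*]\right\},\ \max\left\{r^{\frac{p_*-p}{p_*}}:p\in\left[\tfrac{p_*+1}{2},p_*\right]\right\}\right\},$$ $$d_*=(\mu(\Omega)+1)(c_*+1),\qquad \alpha_*(\varepsilon)=\max\left\{2r,\ r\left(\tfrac{8r}{\varepsilon}\right)^{\frac{2}{p_*-1}}\right\},$$ $$\sigma_*=\min\left\{\tfrac r2,\ 4d_*,\ 4r\mu(\Omega),\ 4d_*\sqrt r\right\}.$$ For $\varepsilon\in(0,\sigma_* )$ put $\alpha_1=2\alpha_*(\varepsilon)$,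 $\alpha_2=3\alpha_*(\varepsilon)$, $\kappa=\frac{\varepsilon}{4\alpha_1\mu(\Omega)}$, $b=\frac{\varepsilon}{4r\mu(\Omega)}$, $h=\frac{64rd_*^2}{\varepsilon^2}$, and $$\delta_1(\varepsilon)=\min\left\{p_*\left[1-\tfrac{1}{1+\log_{b}(1-\kappa)}\right],\ p_*\left[1-\tfrac{1}{1+\log_{\alpha_1/r}(1+\kappa)}\right],\ p_*\left[1-\tfrac{1}{1+\log_{\alpha_1/r}(\alpha_2/\alpha_1)}\right],\ \tfrac{p_*-1}{2}\right\},$$ $$\delta_2(\varepsilon)=\min\left\{p_*\left[\tfrac{1}{1-\log_{r/\alpha_1}(1-\kappa)}-1\right],\ p_*\left[\tfrac{1}{1-\log_{h}(1+\kappa)}-1\right],\ p_*\right\},$$ $$\delta_3(\varepsilon)=\min\left\{p_*\log_{r/\alpha_1}(1-\kappa),\ p_*\log_{h}(1+\kappa),\ \tfrac{p_*-1}{2}\right\},$$ $$\delta_4(\varepsilon)=\min\left\{p_*\log_{\alpha_1/r}(\alpha_2/\alpha_1),\ p_*\log_{b}(1-\kappa),\ p_*\log_{\alpha_1/r}(1+\kappa),\ p_*\right\},$$ $$\delta_*(\varepsilon)=\min\{\delta_1(\varepsilon),\delta_2(\varepsilon)\},\qquad \delta^*(\varepsilon)=\min\{\delta_3(\varepsilon),\delta_4(\varepsilon)\}.$$ *)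

(* Defs.v *)
From HB Require Import structures.
From mathcomp Require Import all_boot all_order all_algebra.
From mathcomp Require Import all_classical all_reals all_analysis.

Set Implicit Arguments.
Unset Strict Implicit.
Unset Printing Implicit Defensive.

Import Order.TTheory GRing.Theory Num.Theory.
Import numFieldTopology.Exports numFieldNormedType.Exports.

Local Open Scope classical_set_scope.
Local Open Scope ring_scope.

Definition separable (X : topologicalType) : Prop :=
  exists D : set X, countable D /\ dense D.

(* An element of a Bochner space is represented by any of its representatives:
   all the quantities below are invariant under equality almost everywhere. *)
Section Bochner.
Context {R : realType} {d : measure_display} {T : measurableType d}.
Context {X : completeNormedModType R}.
Variable mu : {measure set T -> \bar R}.
Implicit Types (x y w : T -> X) (Y W : set (T -> X)).

Definition simple x : Prop :=
  finite_set (range x) /\ forall a : X, measurable (x @^-1` [set a]).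

(* mu-measurability in the sense of Bochner *)
Definition mu_measurable x : Prop :=
  exists s : (T -> X)^nat, (forall n, simple (s n)) /\
    {ae mu, forall t, (fun n => s n t) @ \oo --> x t}.

Definition normLp (p : R) x : \bar R :=
  Lnorm mu p%:E (fun t => (`|x t|)%:E).

Definition Lp (p : R) : set (T -> X) :=
  [set x | mu_measurable x /\ (normLp p x < +oo)%E].

Definition ballLp (p r : R) : set (T -> X) :=
  [set x | Lp p x /\ (normLp p x <= r%:E)%E].

Definition d1 y W : \bar R :=
  ereal_inf [set normLp 1 (y \- w) | w in W].

Definition H1 Y W : \bar R :=
  Order.max (ereal_sup [set d1 y W | y in Y])
            (ereal_sup [set d1 w Y | w in W]).

Definition H1_continuous (I : set R) (F : R -> set (T -> X)) : Prop :=
  forall p0, I p0 -> forall eps : R, 0 < eps ->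
    exists2 delta : R, 0 < delta &
      forall p, I p -> `|p - p0| < delta -> (H1 (F p) (F p0) <= eps%:E)%E.

End Bochner.

Section Constants.
Context {R : realType}.

Definition logb (a x : R) : R := ln x / ln a.

(* The supremum is a maximum in the two uses below, where f is continuous. *)
Definition max_on (f : R -> R) (a b : R) : R := sup (f @` `[a, b]).

(* M stands for mu(Omega), and ps for the fixed exponent. *)
Variables (r M ps : R).

Definition c_star : R :=
  Num.max (max_on (fun p => r `^ ((p - ps) / p)) ps (2 * ps))
          (max_on (fun p => r `^ ((ps - p) / ps)) ((ps + 1) / 2) ps).

Definition d_star : R := (M + 1) * (c_star + 1).

Definition sigma_star : R :=
  Num.min (r / 2) (Num.min (4 * d_star)
    (Num.min (4 * r * M) (4 * d_star * Num.sqrt r))).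

Variable eps : R.

Definition alpha_star : R :=
  Num.max (2 * r) (r * (8 * r / eps) `^ (2 / (ps - 1))).

Definition alpha1 : R := 2 * alpha_star.
Definition alpha2 : R := 3 * alpha_star.
Definition kappa : R := eps / (4 * alpha1 * M).
Definition b_eps : R := eps / (4 * r * M).
Definition h_eps : R := 64 * r * d_star ^+ 2 / eps ^+ 2.

Definition delta1 : R :=
  Num.min (ps * (1 - 1 / (1 + logb b_eps (1 - kappa))))
  (Num.min (ps * (1 - 1 / (1 + logb (alpha1 / r) (1 + kappa))))
  (Num.min (ps * (1 - 1 / (1 + logb (alpha1 / r) (alpha2 / alpha1))))
           ((ps - 1) / 2))).

Definition delta2 : R :=
  Num.min (ps * (1 / (1 - logb (r / alpha1) (1 - kappa)) - 1))
  (Num.min (ps * (1 / (1 - logb h_eps (1 + kappa)) - 1))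
           ps).

Definition delta3 : R :=
  Num.min (ps * logb (r / alpha1) (1 - kappa))
  (Num.min (ps * logb h_eps (1 + kappa))
           ((ps - 1) / 2)).

Definition delta4 : R :=
  Num.min (ps * logb (alpha1 / r) (alpha2 / alpha1))
  (Num.min (ps * logb b_eps (1 - kappa))
  (Num.min (ps * logb (alpha1 / r) (1 + kappa))
           ps)).

Definition delta_lower : R := Num.min delta1 delta2.
Definition delta_upper : R := Num.min delta3 delta4.
Definition delta0 : R := Num.min delta_lower delta_upper.

End Constants.

(* Main.v *)
Require Import Defs.
From HB Require Import structures.
From mathcomp Require Import all_boot all_order all_algebra.
From mathcomp Require Import all_classical all_reals all_analysis.
From mathcomp Require Import measurable_realfun ring lra.

(* The map x |-> (|x| / r)^(q - 1) x with q = p / p' turns |x| / r into its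
   q-th power, hence sends the ball of radius r of L_p into that of L_p'. It
   displaces x pointwise by r |u - u^q|, where u = |x| / r. With A = alpha1 / r
   and b = kappa A, the choice of delta0 makes both A^|q - 1| and b^|q - 1|
   differ from 1 by at most kappa, so |u - u^q| <= 4/3 b on [0, A]. For u > A
   the definition of alpha_star gives u + u^q <= (eps / (4 r)) u^p, so no
   truncation is needed. Integrating, the displacement has L_1 norm at most
   eps / 3 + eps / 4. The roles of p and p' are symmetric. *)

Set Implicit Arguments.
Unset Strict Implicit.
Unset Printing Implicit Defensive.

Import Order.TTheory GRing.Theory Num.Theory.
Import numFieldTopology.Exports numFieldNormedType.Exports.

Local Open Scope classical_set_scope.
Local Open Scope ring_scope.

(** * Measurability and integral comparison up to null sets *)

Section BochnerMeasurability.
Context {R : realType} {d : measure_display} {T : measurableType d}.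
Context {X : completeNormedModType R}.
Variable mu : {measure set T -> \bar R}.
Implicit Types (x s : T -> X) (f g : T -> \bar R).

Import HBNNSimple.

(* No measurability is assumed: t |-> `|x t| need not be measurable for a
   mu-measurable x, as mu may be incomplete, and the integral of a nonnegative
   function is then the supremum of the integrals of the simple functions
   below it. *)
Lemma ae_le_ge0_integral f g :
  (forall t, 0 <= f t)%E -> (forall t, 0 <= g t)%E ->
  {ae mu, forall t, (f t <= g t)%E} ->
  (\int[mu]_t f t <= \int[mu]_t g t)%E.
Proof.
move=> f0 g0 [N [mN N0 NP]]; rewrite ge0_integralTE//.
apply: ge_ereal_sup => _ [h hf <-]; rewrite -integralT_nnsfun.
have mNC : measurable (~` N) by exact: measurableC.
(* Setting [h] to zero on [N] keeps its integral, since [N] is null, and puts it below [g] at every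
   point. *)
apply: (@le_trans _ _ (\int[mu]_t (proj_nnsfun h mNC t)%:E)%E).
  apply: ae_ge0_le_integral => //.
  - by move=> t _; rewrite lee_fin.
  - exact/measurable_EFinP.
  - by move=> t _; rewrite lee_fin.
  - exact/measurable_EFinP.
  - exists N; split=> // t /= ht; apply: contrapT => Nt; apply: ht => _.
    by rewrite /= mindicE mem_set// mulr1.
rewrite [leRHS]ge0_integralTE// integralT_nnsfun.
apply: ereal_sup_ubound; exists (proj_nnsfun h mNC) => //= t.
rewrite mindicE; have [|] := boolP (t \in ~` N).
  rewrite inE => Nt; rewrite mulr1; apply: (le_trans (hf t)).
  by apply: contrapT => ?; apply: Nt; exact: NP.
by rewrite mulr0.
Qed.

Lemma simple_preimage s (B : set X) : simple s -> measurable (s @^-1` B).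
Proof.
move=> [fs ms].
rewrite (_ : s @^-1` B = \bigcup_(a in range s `&` B) s @^-1` [set a]).
  apply: fin_bigcup_measurable => [|a _]; last exact: ms.
  by apply: sub_finite_set fs; exact: subIsetl.
apply/seteqP; split=> [t Bt /=|t [a [_ Ba] /= ->//]].
by exists (s t); [split=> //; exists t|].
Qed.

Lemma simple_comp (g : X -> X) s : simple s -> simple (g \o s).
Proof.
move=> ss; split=> [|a]; last by rewrite comp_preimage; exact: simple_preimage.
by case: ss => fs _; rewrite -(image_comp s); exact: finite_image.
Qed.

Lemma simple_measurable_norm s : simple s ->
  measurable_fun [set: T] (fun t => `|s t|).
Proof.
move=> ss _ B _; rewrite setTI (_ : _ @^-1` B = s @^-1` [set v | B `|v|])//.
exact: simple_preimage.
Qed.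

Lemma mu_measurable_comp (g : X -> X) x : continuous g ->
  mu_measurable mu x -> mu_measurable mu (g \o x).
Proof.
move=> cg [s [ss sx]]; exists (fun n => g \o s n); split.
  by move=> n; exact: simple_comp.
apply: filterS sx => t stx.
exact: (@continuous_cvg _ _ _ _ _ (fun n => s n t) g _ (cg _) stx).
Qed.

(** Cutting the norms of [x] and of the simple functions off on a measurable null set that contains
    all points of non-convergence turns an almost everywhere limit into a limit at every point. The
    resulting [f] stands in for the norm wherever linearity of the integral is used. *)
Lemma mu_measurable_norm x : mu_measurable mu x ->
  exists f : T -> R, [/\ measurable_fun [set: T] f, forall t, 0 <= f t &
    {ae mu, forall t, `|x t| = f t}].
Proof.
move=> [s [ss [N [mN N0 NP]]]].
have mNC : measurable (~` N) by exact: measurableC.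
exists (fun t => `|x t| * \1_(~` N) t); split.
- apply: (@measurable_fun_cvg _ _ _ _
    (fun n t => `|s n t| * \1_(~` N) t)).
    move=> n; apply: measurable_funM; first exact: simple_measurable_norm.
    exact: measurable_indic.
  move=> t _; rewrite indicE; have [|] := boolP (t \in ~` N); last first.
    by rewrite !mulr0 => _; under eq_fun do rewrite mulr0; exact: cvg_cst.
  rewrite inE => Nt; rewrite mulr1; under eq_fun do rewrite mulr1.
  apply: cvg_norm; apply: contrapT => ?; apply: Nt; exact: NP.
- by move=> t; rewrite mulr_ge0.
- exists N; split=> // t /= xt; apply: contrapT => Nt; apply: xt.
  by rewrite indicE mem_set// mulr1.
Qed.

End BochnerMeasurability.

(** * The radial power map and its continuity *)

Lemma powR_continuous_at {R : realType} (a u : R) : 0 < u ->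
  {for u, continuous (fun v : R => v `^ a)}.
Proof.
move=> u0; apply: differentiable_continuous; apply/derivable1_diffP.
by apply: derivable_powR; rewrite in_itv/= u0.
Qed.

Section RadialMap.
Context {R : realType} {X : completeNormedModType R}.
Variables (r q : R).
Hypotheses (r_gt0 : 0 < r) (q_gt0 : 0 < q).
Implicit Types v : X.

(* For q = p / p', composition with this map sends the ball of radius r of L_p
   into that of L_p'. *)
Definition radial v : X := (`|v| / r) `^ (q - 1) *: v.

Lemma norm_radial v : `|radial v| = r * (`|v| / r) `^ q.
Proof.
rewrite normrZ ger0_norm ?powR_ge0// -(@mulr_powRB1 _ (`|v| / r) q)//; last first.
  by rewrite divr_ge0// ltW.
by field; rewrite gt_eqF.
Qed.

Lemma norm_sub_radial v :
  `|v - radial v| = r * `| `|v| / r - (`|v| / r) `^ q|.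
Proof.
rewrite -{1}(scale1r v) -scalerBl normrZ -{2}(ger0_norm (ltW r_gt0)) -normrM.
rewrite -(@mulr_powRB1 _ (`|v| / r) q)//; last by rewrite divr_ge0// ltW.
rewrite -{2}(normr_id v) -normrM; congr `| _ |.
by field; rewrite gt_eqF.
Qed.

Lemma radial_continuous : continuous radial.
Proof.
move=> v; have [->|v0] := eqVneq v 0; last first.
  apply: cvgZ; last exact: cvg_id.
  apply: (@continuous_cvg _ _ _ _ _ (fun w => `|w| / r) (fun u : R => u `^ (q - 1))).
    by apply: powR_continuous_at; rewrite divr_gt0// normr_gt0.
  by apply: cvgMr_tmp; apply: cvg_norm; exact: cvg_id.
rewrite /continuous_at [radial 0]scaler0; apply/cvgr0Pnorm_lt => e e0.
have er0 : 0 < e / r by rewrite divr_gt0.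
near=> w; rewrite norm_radial -ltr_pdivlMl//.
have -> : r^-1 * e = ((e / r) `^ q^-1) `^ q.
  by rewrite -powRrM mulVf ?gt_eqF// powRr1 ?ltW// mulrC.
apply: gt0_ltr_powR => //; rewrite ?nnegrE ?powR_ge0 ?divr_ge0// ?ltW//.
rewrite ltr_pdivrMr//; near: w.
by apply: nbhs0_lt; rewrite mulr_gt0// powR_gt0.
Unshelve. all: by end_near. Qed.

End RadialMap.

(** * Transport of Bochner balls between exponents *)

Section BallTransport.
Context {R : realType} {d : measure_display} {T : measurableType d}.
Context {X : completeNormedModType R}.
Variable mu : {finite_measure set T -> \bar R}.
Implicit Types x : T -> X.

Lemma poweR_normLp (p : R) x : p != 0 ->
  (normLp mu p x `^ p = \int[mu]_t (`|x t| `^ p)%:E)%E.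
Proof.
move=> p0; rewrite /normLp poweR_Lnorm//; apply: eq_integral => t _ /=.
by rewrite normr_id.
Qed.

Lemma normLp_le (p r : R) x : 0 < p -> 0 <= r ->
  ((normLp mu p x <= r%:E) = (\int[mu]_t (`|x t| `^ p)%:E <= (r `^ p)%:E))%E.
Proof.
move=> p0 r0; rewrite -poweR_normLp ?gt_eqF// -poweR_EFin.
have rpos : r%:E \in `[0%E, +oo%E]%R by rewrite in_itv/= lee_fin r0 leey.
have Npos : normLp mu p x \in `[0%E, +oo%E]%R by rewrite in_itv/= Lnorm_ge0 leey.
have powpos (e : \bar R) : (e `^ p)%E \in `[0%E, +oo%E]%R.
  by rewrite in_itv/= poweR_ge0 leey.
have powK (e : \bar R) : (0 <= e)%E -> ((e `^ p) `^ p^-1)%E = e.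
  by move=> e0; rewrite -poweRrM mulfV ?gt_eqF// poweRe1.
apply/idP/idP => [|le]; first by apply: gt0_ler_poweR => //; exact: ltW.
rewrite -(powK r%:E)// -(powK (normLp mu p x)) ?Lnorm_ge0//.
by apply: gt0_ler_poweR => //; rewrite invr_ge0 ltW.
Qed.

Lemma normL1E x : (normLp mu 1 x = \int[mu]_t (`|x t|)%:E)%E.
Proof.
rewrite /normLp Lnorm1; apply: eq_integral => t _ /=.
by rewrite normr_id.
Qed.

Lemma ballLpP (p r : R) x : 0 < p -> 0 <= r ->
  mu_measurable mu x -> (\int[mu]_t (`|x t| `^ p)%:E <= (r `^ p)%:E)%E ->
  ballLp mu p r x.
Proof.
move=> p0 r0 mx xr; have xle : (normLp mu p x <= r%:E)%E by rewrite normLp_le.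
by split=> //; split=> //; rewrite (le_lt_trans xle)// ltry.
Qed.

Lemma ball_transport (r p p' c k : R) : 0 < r -> 0 < p -> 0 < p' ->
  0 <= c -> 0 <= k ->
  (forall u, 0 <= u -> r * `|u - u `^ (p / p')| <= c + k * u `^ p) ->
  forall x, ballLp mu p r x -> exists2 y, ballLp mu p' r y &
    (normLp mu 1 (x \- y)%R <= (c * fine (mu [set: T]) + k)%:E)%E.
Proof.
move=> r0 p0 p'0 c0 k0 ck x [[mx _]]; rewrite normLp_le ?(ltW r0)// => xr.
have q0 : 0 < p / p' by rewrite divr_gt0.
have rp0 : 0 < r `^ p by rewrite powR_gt0.
have [f [mf f0 xf]] := mu_measurable_norm mx.
have mfr : measurable_fun [set: T] (fun t => (f t / r) `^ p).
  apply: (measurableT_comp (measurable_powR p)).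
  by apply: measurable_funM => //; exact: measurable_cst.
have mEfr : measurable_fun [set: T] (fun t => ((f t / r) `^ p)%:E).
  exact/measurable_EFinP.
have fr0 t : (0 <= ((f t / r) `^ p)%:E)%E by rewrite lee_fin powR_ge0.
have J1 : (\int[mu]_t ((f t / r) `^ p)%:E <= 1)%E.
  have -> : (\int[mu]_t ((f t / r) `^ p)%:E =
      ((r `^ p)^-1)%:E * \int[mu]_t (f t `^ p)%:E)%E.
    rewrite -ge0_integralZl_EFin//=; first last.
    - by rewrite invr_ge0 ltW.
    - by apply/measurable_EFinP; apply: (measurableT_comp (measurable_powR p)).
    - by move=> t _; rewrite lee_fin powR_ge0.
    apply: eq_integral => t _; rewrite -EFinM; congr EFin.
    rewrite powRM ?invr_ge0 ?(ltW r0)// mulrC; congr (_ * _).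
    by rewrite -powR_inv1 ?(ltW r0)// powRAC powR_inv1 ?powR_ge0.
  rewrite lee_pdivrMl// mule1; apply: le_trans xr.
  apply: ae_le_ge0_integral => [t|t|]; rewrite ?lee_fin ?powR_ge0//.
  by apply: filterS xf => t ->.
exists (radial r (p / p') \o x).
  apply: (ballLpP p'0 (ltW r0)).
    by apply: mu_measurable_comp mx; exact: radial_continuous.
  apply: (@le_trans _ _ ((r `^ p')%:E * \int[mu]_t ((f t / r) `^ p)%:E)%E).
    rewrite -ge0_integralZl_EFin ?powR_ge0//.
    apply: ae_le_ge0_integral => [t|t|]; rewrite ?lee_fin ?mulr_ge0 ?powR_ge0//.
    apply: filterS xf => t /= xft; rewrite norm_radial// xft -EFinM lee_fin.
    rewrite powRM ?powR_ge0 ?(ltW r0)// -powRrM.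
    by rewrite divfK// gt_eqF.
  by rewrite -[leRHS]mule1 lee_pmul2l// lte_fin powR_gt0.
rewrite normL1E.
apply: (@le_trans _ _ (\int[mu]_t (c%:E + k%:E * ((f t / r) `^ p)%:E))%E).
  apply: ae_le_ge0_integral => [t|t|].
  - by rewrite lee_fin.
  - by rewrite adde_ge0// mule_ge0.
  apply: filterS xf => t /= xft; rewrite norm_sub_radial// xft.
  by rewrite -EFinM -EFinD lee_fin; apply: ck; rewrite divr_ge0// ltW.
rewrite ge0_integralD//; first last.
- by apply: measurable_funeM.
- by move=> t _; rewrite mule_ge0.
rewrite (integral_cst mu measurableT c%:E) ge0_integralZl_EFin//.
rewrite EFinD EFinM fineK ?fin_num_measure//; apply: leeD => //.
by rewrite -[leRHS]mule1 lee_pmul//; apply: integral_ge0 => t _.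
Qed.

End BallTransport.

Section PowerEstimates.
Context {R : realType}.
Implicit Types a b p q u x A K : R.

Lemma powR_logb a x : 0 < a -> a != 1 -> 0 < x -> a `^ logb a x = x.
Proof.
move=> a0 a1 x0; rewrite /powR gt_eqF// divfK ?lnK//.
by rewrite ln_eq0.
Qed.

(** By monotonicity in the base, the power of [u] with exponent [|q - 1|] stays within [kappa] of 1.
    For [q < 1] its inverse [w^-1] is at issue, and dividing by [w >= 1 - kappa >= 3 / 4] costs the
    factor 4 / 3. *)
Lemma powR_sub1_dev kappa b A q u : 0 < kappa <= 1 / 4 -> 0 < b -> b <= u <= A ->
  A `^ `|q - 1| <= 1 + kappa -> 1 - kappa <= b `^ `|q - 1| ->
  `|1 - u `^ (q - 1)| <= 4 / 3 * kappa.
Proof.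
move=> /andP[k0 k4] b0 /andP[bu uA] hA hb.
have u0 : 0 < u by exact: lt_le_trans bu.
have uA1 : u `^ `|q - 1| <= 1 + kappa.
  by apply: le_trans hA; apply: ge0_ler_powR; rewrite ?nnegrE// ltW// (lt_le_trans u0).
have ub1 : 1 - kappa <= u `^ `|q - 1|.
  by apply: (le_trans hb); apply: ge0_ler_powR; rewrite ?nnegrE// ltW.
move: uA1 ub1; have [q1|q1] := leP 0 (q - 1).
  by rewrite ger0_norm// => ? ?; rewrite ler_norml; lra.
have -> : q - 1 = - `|q - 1| by rewrite ltr0_norm// opprK.
rewrite normrN normr_id powRN; set w := _ `^ _ => wle wge.
have w0 : 0 < w by lra.
have -> : 1 - w^-1 = (w - 1) / w by field; lra.
rewrite normrM normfV (gtr0_norm w0) ler_pdivrMr// ler_norml.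
by apply/andP; split; nra.
Qed.

Lemma powR_dev kappa A K p q u : 0 < kappa <= 1 / 4 -> 1 <= A ->
  kappa * A < 1 -> 0 < q -> 0 <= u -> 0 < K ->
  A `^ `|q - 1| <= 1 + kappa -> 1 - kappa <= (kappa * A) `^ `|q - 1| ->
  K <= A `^ (p - 1) -> K <= A `^ (p - q) -> 1 <= p -> q <= p ->
  `|u - u `^ q| <= 4 / 3 * (kappa * A) + 2 / K * u `^ p.
Proof.
move=> kk A1 b1 q0 u0 K0 hA hb Kp Kq p1 qp.
have p0 : 0 < p by exact: lt_le_trans p1.
have /andP[k0 k4] := kk.
have b0 : 0 < kappa * A by apply: mulr_gt0 => //; lra.
have up0 : 0 <= u `^ p by exact: powR_ge0.
have uq0 : 0 <= u `^ q by exact: powR_ge0.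
have tail0 : 0 <= 2 / K * u `^ p by rewrite mulr_ge0// divr_ge0// ltW.
(* Near 0 both [u] and [u]^ q[are small on their own: the latter is at most its value at]b = kappa *
   A[, and]b [^ (q - 1) <= 1 + 4 / 3 * kappa <= 4 / 3]. *)
have [ub|bu] := leP u (kappa * A).
  rewrite -[leLHS]addr0; apply: lerD => //.
  have uqb : u `^ q <= 4 / 3 * (kappa * A).
    apply: (@le_trans _ _ ((kappa * A) `^ q)).
      by apply: ge0_ler_powR => //; rewrite ?nnegrE ltW.
    rewrite -(@mulr_powRB1 _ (kappa * A))// ?(ltW b0)// [leLHS]mulrC ler_pM2r//.
    have bA : kappa * A <= kappa * A <= A by rewrite lexx/=; lra.
    have := powR_sub1_dev kk b0 bA hA hb; rewrite ler_norml => /andP[].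
    by lra.
  by rewrite ler_norml; apply/andP; split; lra.
(* In the middle range [u] is factored out and bounded by [A], the other factor by
   [powR_sub1_dev]. *)
have [uA|Au] := leP u A.
  rewrite -[leLHS]addr0; apply: lerD => //.
  rewrite -(@mulr_powRB1 _ u)// -{1}(mulr1 u) -mulrBr normrM ger0_norm//.
  have := @powR_sub1_dev kappa (kappa * A) A q u kk b0.
  rewrite uA (ltW bu) => /(_ isT hA hb) dev.
  apply: (le_trans (ler_pM u0 (normr_ge0 _) uA dev)); lra.
(* In the tail [u] and [u]^ q[are each at most]u [^ p / K], since the missing powers of [u] exceed
   those of [A]. *)
have u1 : 1 <= u by lra.
have uA0 s : 0 <= s -> A `^ s <= u `^ s.
  by move=> s0; apply: ge0_ler_powR; rewrite ?nnegrE//; lra.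
have h1 : u * K <= u `^ p.
  rewrite -(@mulr_powRB1 _ u)// ler_wpM2l// (le_trans Kp)// uA0//; lra.
have h2 : u `^ q * K <= u `^ p.
  rewrite -[X in _ <= _ `^ X](subrKC q p) powRD; last by apply/implyP => _; rewrite gt_eqF//; lra.
  by rewrite ler_wpM2l// (le_trans Kq)// uA0//; lra.
have -> : 2 / K * u `^ p = u `^ p / K + u `^ p / K by field; lra.
move: h1 h2; rewrite -!ler_pdivlMr// => h1 h2.
by rewrite ler_norml; apply/andP; split; lra.
Qed.

End PowerEstimates.

(** * The explicit constants: positivity, and what they force on the exponents *)

Section ContinuityModulus.
Context {R : realType}.
Implicit Types a b x : R.

Lemma logb_gt1_gt0 a x : 1 < a -> 1 < x -> 0 < logb a x.
Proof. by move=> a1 x1; rewrite divr_gt0// ln_gt0. Qed.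

Lemma logb_lt1_gt0 a x : 0 < a < 1 -> 0 < x < 1 -> 0 < logb a x.
Proof. by move=> a1 x1; rewrite /logb nmulr_lgt0 ?invr_lt0 ln_lt0. Qed.

Lemma logb_gt1_lt1 a x : 1 < a -> 0 < x < a -> logb a x < 1.
Proof.
move=> a1 /andP[x0 xa]; rewrite ltr_pdivrMr ?ln_gt0// mul1r ltr_ln// posrE.
by rewrite (lt_trans x0).
Qed.

Lemma logb_lt1_lt1 a x : 0 < a < 1 -> a < x -> logb a x < 1.
Proof.
move=> /[dup] a1 /andP[a0 _] ax.
by rewrite ltr_ndivrMr ?ln_lt0// mul1r ltr_ln// posrE// (lt_trans a0).
Qed.

Variables (r M ps eps : R).
Hypotheses (r_gt0 : 0 < r) (ps_gt1 : 1 < ps).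

Lemma max_on_ge0 (f : R -> R) a b : (forall x, 0 <= f x) -> 0 <= max_on f a b.
Proof.
move=> f0; rewrite /max_on; set S := f @` _.
(* [sup] takes the default value 0 on a set without supremum, so no boundedness of [f] has to be
   shown. *)
have [hS|/sup_out ->//] := pselect (has_sup S).
have [[y Sy] uS] := hS; apply: (@le_trans _ _ y); last exact: ub_le_sup.
by case: Sy => x _ <-.
Qed.

Lemma d_star_gt0 : 0 < M -> 0 < d_star r M ps.
Proof.
move=> M0; apply: mulr_gt0; first by lra.
suff : 0 <= c_star r ps by lra.
by rewrite /c_star le_max max_on_ge0// => x; exact: powR_ge0.
Qed.

Lemma sigma_star_gt0 : 0 < M -> 0 < sigma_star r M ps.
Proof.
move=> M0; have D0 := d_star_gt0 M0.
rewrite /sigma_star !lt_min; apply/and4P; split; first exact: divr_gt0.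
- exact: mulr_gt0.
- by apply: mulr_gt0 => //; exact: mulr_gt0.
- by apply: mulr_gt0; [exact: mulr_gt0|rewrite sqrtr_gt0].
Qed.

Hypothesis eps_bounds : 0 < eps < sigma_star r M ps.

Local Notation A := (alpha1 r ps eps / r).
Local Notation kap := (kappa r M ps eps).
Local Notation be := (b_eps r M eps).
Local Notation h := (h_eps r M ps eps).

Lemma eps_lt : [/\ 0 < eps, eps < r / 2, eps < 4 * d_star r M ps,
  eps < 4 * r * M & eps < 4 * d_star r M ps * Num.sqrt r].
Proof.
by move: eps_bounds; rewrite /sigma_star !lt_min => /andP[? /and4P[? ? ? ?]].
Qed.

(** Forced by [0 < eps < 4 * r * M]: an admissible [eps] exists only over a space of positive
    mass. *)
Lemma M_gt0 : 0 < M.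
Proof.
have [e0 _ _ eM _] := eps_lt.
have r4 : 0 < 4 * r by exact: mulr_gt0.
by rewrite -(pmulr_rgt0 _ r4) (lt_trans e0 eM).
Qed.

Lemma alpha_star_gt0 : 0 < alpha_star r ps eps.
Proof. by rewrite /alpha_star lt_max mulr_gt0. Qed.

Lemma ratio_ge4 : 4 <= A.
Proof.
rewrite ler_pdivlMr// /alpha1.
have : 2 * r <= alpha_star r ps eps by rewrite /alpha_star le_max lexx.
lra.
Qed.

(** The second term of [alpha_star] is built so that its quotient by [r], raised to [(ps - 1) / 2],
    is exactly [8 * r / eps]. This is the constant [K] of [powR_dev]. *)
Lemma ratio_tail s : (ps - 1) / 2 <= s -> 8 * r / eps <= A `^ s.
Proof.
move=> hs; have [e0 er _ _ _] := eps_lt.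
have K1 : 0 < 8 * r / eps by rewrite divr_gt0// mulr_gt0.
apply: (@le_trans _ _ (A `^ ((ps - 1) / 2))); last first.
  by apply: ler_powR => //; have := ratio_ge4; lra.
have -> : 8 * r / eps = ((8 * r / eps) `^ (2 / (ps - 1))) `^ ((ps - 1) / 2).
  have -> : (ps - 1) / 2 = (2 / (ps - 1))^-1 by rewrite invf_div.
  have c0 : 0 < 2 / (ps - 1) by rewrite divr_gt0// subr_gt0.
  by rewrite -powRrM mulfV ?gt_eqF// powRr1// ltW.
apply: ge0_ler_powR; rewrite ?nnegrE ?powR_ge0//.
- by rewrite divr_ge0// subr_ge0 ltW.
- by apply: le_trans ratio_ge4.
rewrite ler_pdivlMr// /alpha1 mulrC.
have : r * (8 * r / eps) `^ (2 / (ps - 1)) <= alpha_star r ps eps.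
  by rewrite /alpha_star le_max lexx orbT.
by have := alpha_star_gt0; lra.
Qed.

(** The factor [alpha1] cancels, so the lower threshold of [powR_dev] is the base of the logarithms
    in [delta1] and [delta4]. *)
Lemma kappa_ratio : kap * A = be.
Proof.
rewrite /kappa /b_eps /alpha1; field.
by rewrite !gt_eqF ?M_gt0 ?alpha_star_gt0.
Qed.

Lemma b_eps_bounds : 0 < be < 1.
Proof.
have [e0 _ _ eM _] := eps_lt; have rM0 : 0 < 4 * r * M by exact: lt_trans eM.
by rewrite divr_gt0//= ltr_pdivrMr// mul1r.
Qed.

Lemma kappa_bounds : 0 < kap /\ kap * 4 < 1.
Proof.
have k0 : 0 < kap.
  have [e0 _ _ _ _] := eps_lt.
  by rewrite /kappa /alpha1 !(divr_gt0, mulr_gt0) ?alpha_star_gt0 ?M_gt0.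
split=> //; have /andP[_] := b_eps_bounds; apply: le_lt_trans.
by rewrite -kappa_ratio ler_pM2l// ratio_ge4.
Qed.

(** Square the last bound in [sigma_star]. *)
Lemma h_eps_gt4 : 4 < h.
Proof.
have [e0 _ eD _ eDr] := eps_lt.
rewrite /h_eps ltr_pdivlMr ?exprn_gt0//.
have : eps ^+ 2 < (4 * d_star r M ps * Num.sqrt r) ^+ 2.
  by rewrite ltr_pXn2r// ?nnegrE ?ltW// (lt_trans e0).
by rewrite !exprMn sqr_sqrtr ?ltW//; lra.
Qed.

(** [L1] and [L2] are the largest exponents [s] with [be]^ s >= 1 - kap[and]A [^ s <= 1 + kap]
    respectively, as [be < 1 < A]. *)
Let L1 := logb be (1 - kap).
Let L2 := logb A (1 + kap).

Lemma L1_gt0 : 0 < L1.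
Proof.
have [k0 k4] := kappa_bounds.
by apply: logb_lt1_gt0; [exact: b_eps_bounds|apply/andP; split; lra].
Qed.

Lemma L2_gt0 : 0 < L2.
Proof.
have [k0 k4] := kappa_bounds; have := ratio_ge4 => A4.
by apply: logb_gt1_gt0; lra.
Qed.

Lemma shift_lower_gt0 L : 0 < L -> 0 < ps * (1 - 1 / (1 + L)).
Proof.
have p1 := ps_gt1; move=> L0; rewrite (_ : _ * _ = ps * L / (1 + L)); last by field; lra.
by rewrite divr_gt0 ?mulr_gt0//; lra.
Qed.

(** The quantity equals [ps * L / (1 - L)]; this is why the logarithms in [delta2] are also bounded
    above by 1. *)
Lemma shift_upper_gt0 L : 0 < L < 1 -> 0 < ps * (1 / (1 - L) - 1).
Proof.
have p1 := ps_gt1; move=> /andP[L0 L1']; rewrite (_ : _ * _ = ps * L / (1 - L)); last by field; lra.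
by rewrite divr_gt0 ?mulr_gt0//; lra.
Qed.

Lemma alpha2_ratio : alpha2 r ps eps / alpha1 r ps eps = 3 / 2.
Proof. by rewrite /alpha2 /alpha1; field; rewrite gt_eqF// alpha_star_gt0. Qed.

Lemma logb_alpha_ratio_gt0 : 0 < logb A (alpha2 r ps eps / alpha1 r ps eps).
Proof.
by have := ratio_ge4 => A4; rewrite alpha2_ratio; apply: logb_gt1_gt0; lra.
Qed.

Lemma logb_inv_ratio_bounds : 0 < logb (r / alpha1 r ps eps) (1 - kap) < 1.
Proof.
have [k0 k4] := kappa_bounds; have A4 := ratio_ge4.
have A0 : 0 < A by lra.
have -> : r / alpha1 r ps eps = A^-1 by rewrite invf_div.
have Ai4 : A^-1 <= 1 / 4 by rewrite div1r lef_pV2 ?posrE.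
have Ai0 : 0 < A^-1 by rewrite invr_gt0.
by rewrite logb_lt1_gt0 ?logb_lt1_lt1 //; try (apply/andP; split); lra.
Qed.

Lemma logb_h_bounds : 0 < logb h (1 + kap) < 1.
Proof.
have [k0 k4] := kappa_bounds; have h4 := h_eps_gt4.
rewrite logb_gt1_gt0 ?logb_gt1_lt1 //; try (apply/andP; split); lra.
Qed.

Lemma delta_lower_gt0 : 0 < delta_lower r M ps eps.
Proof.
rewrite /delta_lower /delta1 /delta2 !lt_min; apply/andP; split.
  apply/and4P; split; last by rewrite divr_gt0// subr_gt0.
  - exact: shift_lower_gt0 L1_gt0.
  - exact: shift_lower_gt0 L2_gt0.
  - exact: shift_lower_gt0 logb_alpha_ratio_gt0.
apply/and3P; split; last exact: lt_trans ps_gt1.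
- exact: shift_upper_gt0 logb_inv_ratio_bounds.
- exact: shift_upper_gt0 logb_h_bounds.
Qed.

Lemma delta_upper_gt0 : 0 < delta_upper r M ps eps.
Proof.
have ps0 : 0 < ps by exact: lt_trans ps_gt1.
have /andP[l0 _] := logb_inv_ratio_bounds; have /andP[h0 _] := logb_h_bounds.
rewrite /delta_upper /delta3 /delta4 !lt_min !(pmulr_rgt0 _ ps0).
rewrite l0 h0 divr_gt0 ?subr_gt0//= ps0 L1_gt0 L2_gt0.
by rewrite logb_alpha_ratio_gt0.
Qed.

Lemma delta_lower_le : delta_lower r M ps eps <= (ps - 1) / 2.
Proof. by rewrite /delta_lower /delta1 !ge_min lexx !orbT. Qed.

Lemma delta_upper_le : delta_upper r M ps eps <= (ps - 1) / 2.
Proof. by rewrite /delta_upper /delta3 !ge_min lexx !orbT. Qed.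

Lemma delta0_bounds : 0 < delta0 r M ps eps <= (ps - 1) / 2.
Proof.
by rewrite /delta0 lt_min delta_lower_gt0 delta_upper_gt0 ge_min delta_lower_le.
Qed.

(** Both quotients occur because balls are transported in both directions. The second has
    denominator [p], possibly below [ps]; the bound [ps * L / (1 + L)] on the distance forces
    [p >= ps / (1 + L)], which compensates. *)
Lemma quotient_near p L : 0 < L -> 0 < p ->
  `|p - ps| <= ps * L -> `|p - ps| <= ps * (1 - 1 / (1 + L)) ->
  `|p / ps - 1| <= L /\ `|ps / p - 1| <= L.
Proof.
move=> L0 p0 pL; have ps0 : 0 < ps by exact: lt_trans ps_gt1.
rewrite (_ : _ * (1 - _) = ps * L / (1 + L)); last by field; lra.
rewrite ler_pdivlMr ?addr_gt0// => pL'.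
have -> : p / ps - 1 = (p - ps) / ps by field; lra.
have -> : ps / p - 1 = - ((p - ps) / p) by field; lra.
rewrite normrN !normrM !normfV (gtr0_norm p0) (gtr0_norm ps0) !ler_pdivrMr//.
split; first by rewrite mulrC.
have : ps - p <= `|p - ps| by rewrite distrC ler_norm.
nra.
Qed.

Lemma delta0_near p : `|p - ps| < delta0 r M ps eps ->
  let q := p / ps in let q' := ps / p in
  [/\ (ps + 1) / 2 < p, `|q - 1| <= L1, `|q - 1| <= L2,
      `|q' - 1| <= L1 & `|q' - 1| <= L2].
Proof.
have ps1 := ps_gt1; move=> pd q q'; have /andP[_ d2] := delta0_bounds.
have p1 : (ps + 1) / 2 < p.
  have := lt_le_trans pd d2; rewrite ltr_norml => /andP[+ _]; lra.
move: (ltW pd); rewrite /delta0 /delta_lower /delta_upper !le_min.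
(* [a1] and [a2] come from [delta1], [a3] and [a4] from [delta4]; [a1], [a3] involve [L1] and [a2],
   [a4] involve [L2], as [quotient_near] requires. *)
rewrite -!andbA => /and5P[a1 a2 _ _ /and5P[_ _ _ _ /and5P[_ _ _ a3 /andP[a4 _]]]].
have p0 : 0 < p by lra.
have [? ?] := quotient_near L1_gt0 p0 a3 a1.
by have [? ?] := quotient_near L2_gt0 p0 a4 a2.
Qed.

(** This is [powR_dev] with [K = 8 * r / eps], scaled by [r]: [r * (4 / 3) * be = eps / (3 * M)] and
    [r * 2 / K = eps / 4]. *)
Lemma radial_dev p q : 0 < q -> (ps - 1) / 2 <= p - 1 -> (ps - 1) / 2 <= p - q ->
  `|q - 1| <= L1 -> `|q - 1| <= L2 -> forall u, 0 <= u ->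
  r * `|u - u `^ q| <= eps / (3 * M) + eps / 4 * u `^ p.
Proof.
move=> q0 p1 pq qL1 qL2 u u0.
have [e0 _ _ _ _] := eps_lt; have M0 := M_gt0.
have [k0 k4] := kappa_bounds; have A4 := ratio_ge4.
have /andP[b0 b1] := b_eps_bounds.
have K0 : 0 < 8 * r / eps by rewrite divr_gt0// mulr_gt0.
have hA : A `^ `|q - 1| <= 1 + kap.
  rewrite -[leRHS](@powR_logb _ A) ?gt_eqF//; try lra.
  by apply: ler_powR => //; lra.
have hb : 1 - kap <= (kap * A) `^ `|q - 1|.
  rewrite kappa_ratio -[leLHS](@powR_logb _ be) ?lt_eqF//; last by lra.
  by apply: ger_powR => //; rewrite b0 ltW.
have ps1 := ps_gt1.
have dev : `|u - u `^ q| <= 4 / 3 * (kap * A) + 2 / (8 * r / eps) * u `^ p.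
  apply: powR_dev => //; try exact: ratio_tail; rewrite ?kappa_ratio //; try lra.
rewrite kappa_ratio in dev.
apply: (@le_trans _ _ (r * (4 / 3 * be + 2 / (8 * r / eps) * u `^ p))).
  by rewrite ler_pM2l.
rewrite le_eqVlt; apply/orP; left; apply/eqP; rewrite /b_eps; field.
by rewrite !gt_eqF.
Qed.

End ContinuityModulus.

(** * From partners of points to the Hausdorff distance of balls *)

Section HausdorffBound.
Context {R : realType} {d : measure_display} {T : measurableType d}.
Context {X : completeNormedModType R}.
Variable mu : {finite_measure set T -> \bar R}.
Implicit Types (x : T -> X) (Y W : set (T -> X)).

Lemma H1_le (e : \bar R) Y W :
  (forall y, Y y -> exists2 w, W w & (normLp mu 1 (y \- w)%R <= e)%E) ->
  (forall w, W w -> exists2 y, Y y & (normLp mu 1 (w \- y)%R <= e)%E) ->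
  (H1 mu Y W <= e)%E.
Proof.
have d1_le Y' W' :
    (forall y, Y' y -> exists2 w, W' w & (normLp mu 1 (y \- w)%R <= e)%E) ->
    (ereal_sup [set d1 mu y W' | y in Y'] <= e)%E.
  move=> YW; apply: ge_ereal_sup => _ [y /YW[w Ww le] <-].
  by apply: ge_ereal_inf; exists (normLp mu 1 (y \- w)%R) => //; exists w.
by move=> YW WY; rewrite /H1 ge_max !d1_le.
Qed.

Lemma normLp_null (p : R) x : mu [set: T] = 0%E -> 0 < p -> normLp mu p x = 0%E.
Proof.
move=> mu0 p0; apply/eqP; rewrite eq_le Lnorm_ge0 andbT normLp_le// powR0 ?gt_eqF//.
apply: (@le_trans _ _ (\int[mu]_t cst 0 t)%E); last by rewrite integral0.
apply: ae_le_ge0_integral => //.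
by exists [set: T].
Qed.

(** Over a null space all norms vanish, so each function is its own partner in the other ball. *)
Lemma H1_ball_null (p p' r : R) : mu [set: T] = 0%E -> 0 < p -> 0 < p' ->
  0 < r -> (H1 mu (ballLp mu p r : set (T -> X)) (ballLp mu p' r) <= 0)%E.
Proof.
move=> mu0 p0 p'0 r0.
have sub (s s' : R) x : 0 < s' -> ballLp mu s r x ->
    exists2 w, ballLp mu s' r w & (normLp mu 1 (x \- w)%R <= 0)%E.
  move=> s'0 [[mx _] _]; exists x; last by rewrite (normLp_null _ mu0).
  have x0 := normLp_null x mu0 s'0.
  by split; [split|]; rewrite /= ?x0 ?lee_fin ?ltW.
by apply: H1_le => y; exact: sub.
Qed.

Lemma H1_ball_le (r ps eps : R) : 0 < r -> 1 < ps ->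
  let M := fine (mu [set: T]) in 0 < eps < sigma_star r M ps ->
  forall p, `|p - ps| < delta0 r M ps eps ->
  (H1 mu (ballLp mu p r : set (T -> X)) (ballLp mu ps r) <= eps%:E)%E.
Proof.
move=> r0 ps1 M epsB p pd.
have [p1 qL1 qL2 q'L1 q'L2] := delta0_near r0 ps1 epsB pd.
have M0 : 0 < M := M_gt0 r0 epsB; have [e0 _ _ _ _] := eps_lt epsB.
have p0 : 0 < p by lra.
have ps0 : 0 < ps by lra.
have c0 : 0 <= eps / (3 * M) by rewrite divr_ge0 ?mulr_ge0 ?ltW.
have k0 : 0 <= eps / 4 by rewrite divr_ge0 ?ltW.
have bound : ((eps / (3 * M) * M + eps / 4)%:E <= eps%:E)%E.
  rewrite lee_fin (_ : eps / (3 * M) * M = eps / 3); first by lra.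
  by field; rewrite gt_eqF.
(* The difference is [(p / ps) * (ps - 1)], and [p > (ps + 1) / 2] makes the first factor exceed 1 /
   2. *)
have qp : (ps - 1) / 2 <= p - p / ps.
  have : p / ps * ps = p by rewrite divfK// gt_eqF.
  have : 0 < p / ps by rewrite divr_gt0.
  by nra.
(* The right side increases with [p], and at [p = (ps + 1) / 2] it is [ps * (ps - 1) / (ps + 1)],
   already above the left side. *)
have q'p : (ps - 1) / 2 <= ps - ps / p.
  have : ps / p * p = ps by rewrite divfK// gt_eqF.
  have : 0 < ps / p by rewrite divr_gt0.
  by nra.
apply: H1_le => [x Bx|x Bx].
  have dev := radial_dev r0 ps1 epsB (divr_gt0 p0 ps0) _ qp qL1 qL2.
  have [|y By xy] := ball_transport r0 p0 ps0 c0 k0 (dev _) Bx; first by lra.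
  by exists y => //; exact: le_trans bound.
have dev := radial_dev r0 ps1 epsB (divr_gt0 ps0 p0) _ q'p q'L1 q'L2.
have [|y By xy] := ball_transport r0 ps0 p0 c0 k0 (dev _) Bx; first by lra.
by exists y => //; exact: le_trans bound.
Qed.

End HausdorffBound.

Theorem theorem5p1 (R : realType) (d : measure_display) (T : measurableType d)
    (mu : {finite_measure set T -> \bar R}) (X : completeNormedModType R)
    (sepX : separable X) (r : R) (r_gt0 : 0 < r) :
  H1_continuous mu [set p : R | 1 < p] (fun p => @ballLp R d T X mu p r) /\
  forall ps eps : R, 1 < ps ->
    let M := fine (mu [set: T]) in
    0 < eps < sigma_star r M ps ->
    [/\ 0 < delta_lower r M ps eps <= (ps - 1) / 2,
        0 < delta_upper r M ps eps <= (ps - 1) / 2,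
        0 < delta0 r M ps eps <= (ps - 1) / 2 &
        forall p : R,
          ps - delta0 r M ps eps < p < ps + delta0 r M ps eps ->
          (H1 mu (@ballLp R d T X mu p r) (@ballLp R d T X mu ps r)
             <= eps%:E)%E].
Proof.
split=> [p0 p0_gt1 e e_gt0|ps eps ps_gt1 M epsB]; last first.
  split; last first.
  - move=> p /andP[pl pu]; apply: H1_ball_le => //.
    by rewrite ltr_norml; apply/andP; split; lra.
  - exact: delta0_bounds.
  - by rewrite delta_upper_gt0// delta_upper_le.
  - by rewrite delta_lower_gt0// delta_lower_le.
(* Zero mass is treated apart: the interval of admissible [eps] is then empty. *)
have [mu0|mu_neq0] := eqVneq (mu [set: T]) 0%E.
  exists 1 => // p /= p1 _; apply: le_trans (_ : 0 <= e%:E)%E; last first.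
    by rewrite lee_fin ltW.
  by apply: H1_ball_null => //; exact: lt_trans ltr01 _.
have M0 : 0 < fine (mu [set: T]).
  by rewrite fine_gt0// lt0e mu_neq0 measure_ge0 ltey_eq fin_num_measure.
have s0 := sigma_star_gt0 p0 r_gt0 M0.
(* An arbitrary [e] is lowered into the admissible interval; half of [sigma_star] keeps the upper
   bound strict. *)
pose e' := Num.min e (sigma_star r (fine (mu [set: T])) p0 / 2).
have e'B : 0 < e' < sigma_star r (fine (mu [set: T])) p0.
  rewrite lt_min e_gt0 divr_gt0//= gt_min; apply/orP; right.
  by rewrite ltr_pdivrMr// ltr_pMr// ltr1n.
exists (delta0 r (fine (mu [set: T])) p0 e').
  by have /andP[] := delta0_bounds r_gt0 p0_gt1 e'B.
move=> p _ pd; apply: (@le_trans _ _ e'%:E); first exact: H1_ball_le.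
by rewrite lee_fin ge_min lexx.
Qed.
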